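(* Let $\widehat u=(\widehat u_-,\widehat u_+)\in\mathbb{C}^2$ with $\widehat u_-\neq0$ and $\widehat u_+\neq0$. There exist a constant $L=L(\widehat u)>0$ and a continuous function $$E_{\widehat u}:\{\lambda\in\mathbb{C}:|\lambda|\ge L\}\to\mathbb{C}^2$$ with the following property: if in system (S) the injected field is of the form $u=\lambda\widehat u$ with $|\lambda|\ge L$, then a triple $(E,N,n)\in\mathbb{C}^2\times\mathbb{R}\times\mathbb{R}$ is an equilibrium point of (S) if and only if $$E=E_{\widehat u}(\lambda)\quad\text{and}\quad(N,n)=y(|E_-|,|E_+|).$$ Furthermore, there exists a constant $C=C(\widehat u)>0$ such that the function $E_{\widehat u}$ satisfies $$E_{\widehat u}(\lambda)=\frac{\lambda e^{i\theta}}{|1+i\alpha|}\big(\widehat u+e(\lambda)\big),\quad\text{where } |e(\lambda)|\le\frac{C}{|\lambda|^{2/3}}\ \text{ and }\ \theta:=-\arg(1+i\alpha).$$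
   Context: Fixed real parameters: $\kappa,\gamma,\delta\in(0,\infty)$, $\alpha\in\mathbb{R}$, $\mu>1$ (constants may depend on them). For $z=(z_1,z_2)\in\mathbb{C}^2$ define $$X(z):=\begin{bmatrix}1-(z_1-z_2)&0\\0&1-(z_1+z_2)\end{bmatrix},\qquad Y(z):=\begin{bmatrix}1+|z|^2&|z_2|^2-|z_1|^2\\ |z_2|^2-|z_1|^2&\delta+|z|^2\end{bmatrix}.$$ For a constant $u=(u_-,u_+)\in\mathbb{C}^2$, system (S) is the following system of ODEs for $E(t)=(E_-(t),E_+(t))\in\mathbb{C}^2$ and $N(t),n(t)\in\mathbb{R}$: $$\frac{d}{dt}E=-\kappa\big((1+i\alpha)X(N,n)E-u\big),\qquad \frac{d}{dt}\begin{bmatrix}N\\ n\end{bmatrix}=-\gamma\Big(Y(E)\begin{bmatrix}N\\ n\end{bmatrix}-\begin{bmatrix}\mu\\0\end{bmatrix}\Big).\tag{S}$$ An equilibrium point of (S) is a triple $(E,N,n)\in\mathbb{C}^2\times\mathbb{R}\times\mathbb{R}$ at which both right-hand sides vanish. The function $y:\mathbb{R}^2\to\mathbb{R}^2$ is $$y(x):=Y(x)^{-1}\begin{bmatrix}\mu\\0\end{bmatrix}=\frac{\mu}{\det Y(x)}\begin{bmatrix}\delta+|x|^2\\ x_1^2-x_2^2\end{bmatrix},\qquad \det Y(x)=\delta+(1+\delta)|x|^2+4x_1^2x_2^2>0.$$ *)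

(* Defs.v *)
From mathcomp Require Export all_boot all_order all_algebra.
From mathcomp Require Export all_classical all_reals all_analysis.
From mathcomp.real_closed Require Export complex.
From mathcomp Require Import ring lra.

Export numFieldNormedType.Exports.
Export Order.TTheory GRing.Theory Num.Theory.

Set Implicit Arguments.
Unset Strict Implicit.
Unset Printing Implicit Defensive.

Local Open Scope classical_set_scope.
Local Open Scope ring_scope.
Local Open Scope complex_scope.

(* The [R]-valued modulus; MathComp's [`|z|] is valued in [R[i]]. *)
Notation cmod := ComplexField.Normc.normc.

Definition col2 (T : Type) (a b : T) : 'cV[T]_2 :=
  \col_i (if i == 0 then a else b).

Definition mx22 (T : Type) (a b c d : T) : 'M[T]_2 :=
  \matrix_(i, j) (if i == 0 then if j == 0 then a else b
                  else if j == 0 then c else d).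

(* For [z] in C^2, the components (z_1, z_2), also written (z_-, z_+). *)
Notation fst2 z := (z 0 0).
Notation snd2 z := (z 1 0).

Definition norm2 (R : realType) (z : 'cV[R[i]]_2) : R :=
  Num.sqrt (cmod (fst2 z) ^+ 2 + cmod (snd2 z) ^+ 2).

(* Principal argument, in ]-pi, pi]; only meaningful for [z != 0]. *)
Definition carg (R : realType) (z : R[i]) : R :=
  if 0 <= complex.Im z then acos (complex.Re z / cmod z) else - acos (complex.Re z / cmod z).

Definition expi (R : realType) (t : R) : R[i] := cos t +i* sin t.

Definition X (R : realType) (z : 'cV[R[i]]_2) : 'M[R[i]]_2 :=
  mx22 (1 - (fst2 z - snd2 z)) 0
       0                       (1 - (fst2 z + snd2 z)).

Definition Y (R : realType) (delta : R) (z : 'cV[R[i]]_2) : 'M[R]_2 :=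
  mx22 (1 + norm2 z ^+ 2) (cmod (snd2 z) ^+ 2 - cmod (fst2 z) ^+ 2)
       (cmod (snd2 z) ^+ 2 - cmod (fst2 z) ^+ 2) (delta + norm2 z ^+ 2).

(* [x] in R^2 is viewed in C^2.  For [0 < delta], [Y delta x] is invertible
   ([det_Y_gt0] below), so [invmx] is a true inverse. *)
Definition y (R : realType) (delta mu : R) (x : 'cV[R]_2) : 'cV[R]_2 :=
  invmx (Y delta (map_mx (fun r : R => r%:C) x)) *m col2 mu 0.

(* Right-hand sides of the system
     E'      = - kappa ((1 + i alpha) X(N, n) E - u),
     (N, n)' = - gamma (Y(E) (N, n) - (mu, 0)). *)
Definition fieldE (R : realType) (kappa alpha : R) (u E : 'cV[R[i]]_2)
    (N n : R) : 'cV[R[i]]_2 :=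
  - (kappa%:C *: ((1 +i* alpha) *: X (col2 N%:C n%:C) *m E - u)).

Definition fieldN (R : realType) (gamma delta mu : R) (E : 'cV[R[i]]_2)
    (N n : R) : 'cV[R]_2 :=
  - (gamma *: (Y delta E *m col2 N n - col2 mu 0)).

Definition equilibrium (R : realType) (kappa gamma delta alpha mu : R)
    (u E : 'cV[R[i]]_2) (N n : R) : Prop :=
  fieldE kappa alpha u E N n = 0 /\ fieldN gamma delta mu E N n = 0.

(* The topology used for continuity is the norm topology of [R[i]^o] and the
   product topology on its column vectors. *)
Definition continuous_on (R : realType) (D : set R[i])
    (f : R[i] -> 'cV[R[i]]_2) : Prop :=
  {within (D : set R[i]^o), continuous (f : R[i]^o -> 'cV[R[i]^o]_2)}.

Lemma det_mx22 (T : comPzRingType) (a b c d : T) :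
  \det (mx22 a b c d) = a * d - b * c.
Proof.
rewrite (expand_det_row _ 0) big_ord_recl big_ord1 /cofactor !det_mx11 !mxE /=.
by rewrite expr0 expr1 mul1r mulN1r mulrN.
Qed.

Lemma Y_real (R : realType) (delta a b : R) :
  Y delta (col2 a%:C b%:C) =
  mx22 (1 + (a ^+ 2 + b ^+ 2)) (b ^+ 2 - a ^+ 2)
       (b ^+ 2 - a ^+ 2) (delta + (a ^+ 2 + b ^+ 2)).
Proof.
have cE (r : R) : cmod r%:C ^+ 2 = r ^+ 2.
  by rewrite /= expr0n addr0 sqr_sqrtr ?sqr_ge0.
by rewrite /Y /norm2 !mxE !cE sqr_sqrtr // addr_ge0 ?sqr_ge0.
Qed.

Lemma det_Y (R : realType) (delta a b : R) :
  \det (Y delta (col2 a%:C b%:C)) =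
  delta + (1 + delta) * (a ^+ 2 + b ^+ 2) + 4 * a ^+ 2 * b ^+ 2.
Proof. by rewrite Y_real det_mx22; ring. Qed.

Lemma det_Y_gt0 (R : realType) (delta a b : R) :
  0 < delta -> 0 < \det (Y delta (col2 a%:C b%:C)).
Proof.
move=> d_gt0; rewrite det_Y; have [a2 b2] := (sqr_ge0 a, sqr_ge0 b).
by have := mulr_ge0 a2 b2; nra.
Qed.

Lemma y_explicit (R : realType) (delta mu a b : R) (delta_gt0 : 0 < delta) :
  y delta mu (col2 a b) =
  (mu / \det (Y delta (col2 a%:C b%:C))) *:
    col2 (delta + (a ^+ 2 + b ^+ 2)) (a ^+ 2 - b ^+ 2).
Proof.
have d0 : \det (Y delta (col2 a%:C b%:C)) != 0 by rewrite gt_eqF ?det_Y_gt0.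
have Yu : Y delta (col2 a%:C b%:C) \in unitmx by rewrite unitmxE unitfE.
have -> : y delta mu (col2 a b) =
    invmx (Y delta (col2 a%:C b%:C)) *m col2 mu 0.
  by congr (invmx (Y _ _) *m _); apply/matrixP => i j; rewrite !mxE; case: ifP.
rewrite det_Y in d0 *; apply: (canLR (mulKmx Yu)).
rewrite Y_real; apply/matrixP => i j; rewrite !mxE big_ord_recl big_ord1 !mxE /=.
by case: i => [[|[|//]] ?] /=; field.
Qed.

(* Main.v *)
From HB Require Import structures.
From mathcomp Require Import ring lra.
Require Import Defs.

Set Implicit Arguments.
Unset Strict Implicit.
Unset Printing Implicit Defensive.

Local Open Scope ring_scope.
Local Open Scope classical_set_scope.
Local Open Scope complex_scope.

(** Put [w = uh / (1 + i alpha)].  At an equilibrium [(N, n)] is determined by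
    the moduli of the components of [E], and the equation for [E] decouples into
      [(1 - x) E_- = lambda w_-]  and  [(1 - y) E_+ = lambda w_+],
    where [x = N - n] and [y = N + n] are real ([equilibriumE]).  Hence [E] is
    known as soon as [x] and [y] are, and it has the phases of [lambda w].
    Both [x] and [y] are values of one explicit function [gain] of the
    intensities [|E_-|^2] and [|E_+|^2] ([y_gain]), so the problem reduces to
    two real equations in which only [|lambda|] occurs.

    Two properties of [gain] drive the proof.  It is at most [2 mu], so
    [|E_-|] and [|E_+|] are at least of order [|lambda|]; and it decays like
    the inverse of the intensity ([gain_decay]), so at any equilibrium [x] and
    [y] are [O(|lambda|^-2)].  In the parameter [eps = |lambda|^-2] the two
    equations then take the form [(x, y) = eps *: Phi eps (x, y)] with [Phi]
    bounded and Lipschitz up to [eps = 0] ([gain_rescale],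
    [rgain_bounded_lipschitz]): for small [eps] this is a contraction, whose
    unique fixed point is Lipschitz in [eps] ([small_fixed_point],
    [gain_branch]).  This gives existence, uniqueness and continuity of the
    branch [E(lambda)].

    As [1 / (1 + i alpha) = e^(i theta) / |1 + i alpha|], the relative error is
    [e_- = uh_- x / (1 - x)], and similarly for [e_+]; it is
    [O(|lambda|^-2)], which is stronger than [O(|lambda|^(-2/3))] since
    [|lambda| >= 1]. *)

(** * Bounded Lipschitz functions *)

(** Boundedness is part of the notion because it is what makes the class
    closed under products; one constant serves both bounds. *)
Definition bounded_lipschitz (R : realType) (V : normedModType R) (D : set V)
    (f : V -> R) : Prop :=
  exists K : R, forall u v, D u -> D v ->
    `|f u| <= K /\ `|f u - f v| <= K * `|u - v|.

Lemma bounded_lipschitz_cst (R : realType) (V : normedModType R) (D : set V)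
    (c : R) : bounded_lipschitz D (fun=> c).
Proof. by exists `|c| => u v _ _; rewrite subrr normr0 mulr_ge0. Qed.

Lemma bounded_lipschitzD (R : realType) (V : normedModType R) (D : set V)
    (f g : V -> R) :
  bounded_lipschitz D f -> bounded_lipschitz D g ->
  bounded_lipschitz D (fun u => f u + g u).
Proof.
move=> [K Kf] [M Mg]; exists (K + M) => u v Du Dv.
have [[fu fuv] [gu guv]] := (Kf u v Du Dv, Mg u v Du Dv).
split; first exact: le_trans (ler_normD _ _) (lerD fu gu).
by rewrite opprD addrACA mulrDl (le_trans (ler_normD _ _)) ?lerD.
Qed.

Lemma bounded_lipschitzM (R : realType) (V : normedModType R) (D : set V)
    (f g : V -> R) :
  bounded_lipschitz D f -> bounded_lipschitz D g ->
  bounded_lipschitz D (fun u => f u * g u).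
Proof.
move=> [K Kf] [M Mg]; exists (K * M + K * M) => u v Du Dv.
have [[fu fuv] [gu guv]] := (Kf u v Du Dv, Mg u v Du Dv).
have [gv _] := Mg v v Dv Dv.
have K0 : 0 <= K := le_trans (normr_ge0 _) fu.
have M0 : 0 <= M := le_trans (normr_ge0 _) gu.
have KM0 := mulr_ge0 K0 M0.
split; first by rewrite normrM (le_trans (ler_pM _ _ fu gu)) // lerDl.
have -> : f u * g u - f v * g v = f u * (g u - g v) + (f u - f v) * g v by ring.
rewrite (le_trans (ler_normD _ _)) // !normrM mulrDl lerD //.
  by rewrite -mulrA ler_pM.
by rewrite [K * M * _]mulrAC ler_pM.
Qed.

Lemma bounded_lipschitzX (R : realType) (V : normedModType R) (D : set V)
    (f : V -> R) n :
  bounded_lipschitz D f -> bounded_lipschitz D (fun u => f u ^+ n).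
Proof.
move=> Lf; elim: n => [|n IHn]; first exact: bounded_lipschitz_cst.
by under eq_fun do rewrite exprS; exact: bounded_lipschitzM.
Qed.

Lemma bounded_lipschitzV (R : realType) (V : normedModType R) (D : set V)
    (f : V -> R) (c : R) :
  0 < c -> (forall u, D u -> c <= f u) ->
  bounded_lipschitz D f -> bounded_lipschitz D (fun u => (f u)^-1).
Proof.
move=> c0 cf [K Kf]; exists (c^-1 + K * c ^- 2) => u v Du Dv.
have [fu fuv] := Kf u v Du Dv.
have K0 : 0 <= K := le_trans (normr_ge0 _) fu.
have [fu0 fv0] : 0 < f u /\ 0 < f v by split; exact: lt_le_trans (cf _ _).
have Vle w : D w -> (f w)^-1 <= c^-1.
  by move=> Dw; rewrite lef_pV2 ?posrE ?cf // (lt_le_trans c0 (cf _ Dw)).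
split.
  rewrite ger0_norm ?invr_ge0 ?(ltW fu0) // (le_trans (Vle _ Du)) // lerDl.
  by rewrite mulr_ge0 // invr_ge0 exprn_ge0 // ltW.
have -> : (f u)^-1 - (f v)^-1 = (f v - f u) * ((f u)^-1 * (f v)^-1).
  by field; rewrite !gt_eqF.
rewrite normrM distrC [`|_ * (f v)^-1|]ger0_norm; last first.
  by rewrite mulr_ge0 ?invr_ge0 ?(ltW fu0) ?(ltW fv0).
rewrite mulrDl -[leLHS]add0r lerD ?mulr_ge0 ?invr_ge0 ?(ltW c0) //.
rewrite [K * _ * _]mulrAC ler_pM ?mulr_ge0 ?invr_ge0 ?(ltW fu0) ?(ltW fv0) //.
by rewrite -exprVn expr2 ler_pM ?invr_ge0 ?Vle ?ltW.
Qed.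

(** * Fixed points with a small parameter *)

(** The factor [eps] turns any bounded Lipschitz map into a contraction of the
    ball of radius [r] as soon as [eps * K <= r] and [eps * K <= 1 / 2].  The
    Lipschitz dependence on [eps] is the usual estimate: two fixed points at
    distance [d] satisfy [d <= (K + 1 / 2) |eps - eps'| + d / 2].  The same
    estimate with [eps = eps'] gives uniqueness. *)
Lemma small_fixed_point (R : realType) (V : completeNormedModType R)
    (Phi : R -> V -> V) (r K : R) :
  0 < r -> 0 < K ->
  (forall eps v, 0 <= eps <= 1 -> `|v| <= r -> `|Phi eps v| <= K) ->
  (forall eps eps' v v', 0 <= eps <= 1 -> 0 <= eps' <= 1 ->
     `|v| <= r -> `|v'| <= r ->
     `|Phi eps v - Phi eps' v'| <= K * (`|eps - eps'| + `|v - v'|)) ->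
  exists (eps0 : R) (z : R -> V), [/\ 0 < eps0,
    forall eps, 0 <= eps <= eps0 ->
      `|z eps| <= r /\ z eps = eps *: Phi eps (z eps),
    forall eps v, 0 <= eps <= eps0 -> `|v| <= r ->
      v = eps *: Phi eps v -> v = z eps
    & forall eps eps', 0 <= eps <= eps0 -> 0 <= eps' <= eps0 ->
      `|z eps - z eps'| <= (2 * K + 1) * `|eps - eps'| ].
Proof.
move=> r0 K0 PhiK PhiL.
pose eps0 := Num.min 1 (Num.min (r / K) (2 * K)^-1).
have small eps : 0 <= eps <= eps0 ->
    [/\ 0 <= eps <= 1, eps * K <= r & eps * K <= 1 / 2].
  move=> /andP[e0]; rewrite !le_min => /and3P[e1 er eK].
  split; first by rewrite e0.
    by rewrite -ler_pdivlMr.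
  by move: eK; rewrite invfM -ler_pdivlMr ?div1r.
have key eps eps' v v' : 0 <= eps <= eps0 -> 0 <= eps' <= eps0 ->
    `|v| <= r -> `|v'| <= r ->
    `|eps *: Phi eps v - eps' *: Phi eps' v'| <=
    (K + 1 / 2) * `|eps - eps'| + 1 / 2 * `|v - v'|.
  move=> /small[e1 _ _] /small[e1' _ eK] vr vr'.
  have -> : eps *: Phi eps v - eps' *: Phi eps' v' =
      (eps - eps') *: Phi eps v + eps' *: (Phi eps v - Phi eps' v').
    by rewrite scalerBl scalerBr addrA subrK.
  rewrite (le_trans (ler_normD _ _)) // !normrZ mulrDl -addrA lerD //.
    by rewrite mulrC ler_wpM2r // PhiK.
  have /andP[e0' _] := e1'.
  rewrite (ger0_norm e0') -mulrDr.
  apply: (@le_trans _ _ (eps' * (K * (`|eps - eps'| + `|v - v'|)))).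
    by rewrite ler_wpM2l ?PhiL.
  by rewrite mulrA ler_wpM2r ?addr_ge0.
pose z eps := xget 0 [set v | `|v| <= r /\ v = eps *: Phi eps v].
have zP eps : 0 <= eps <= eps0 ->
    `|z eps| <= r /\ z eps = eps *: Phi eps (z eps).
  move=> ee; apply: (@xgetPex _ 0 [set v | `|v| <= r /\ v = eps *: Phi eps v]).
  have [e1 er _] := small _ ee; have /andP[e0 _] := e1.
  pose U : set V := closed_ball_ Num.norm 0 r.
  have UE v : U v <-> `|v| <= r by rewrite /U /closed_ball_ /= sub0r normrN.
  have gU : {homo (fun v => eps *: Phi eps v) : v / U v >-> U v}.
    move=> v /UE vr; apply/UE; rewrite normrZ ger0_norm //.
    by apply: le_trans er; rewrite ler_wpM2l ?PhiK.
  have [] := @banach_fixed_point _ _ U (mkfun_fun gU).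
  - exists (widen_itv ((1/2 : R)%:itv)); split => /=; first by lra.
    move=> [v v'] [/= /UE vr /UE vr'].
    by have := key _ _ _ _ ee ee vr vr'; rewrite subrr normr0 mulr0 add0r.
  - exact: closed_closed_ball_.
  - by exists 0; apply/UE; rewrite normr0 ltW.
  - by move=> v /UE vr vE; exists v.
have lip eps eps' v v' : 0 <= eps <= eps0 -> 0 <= eps' <= eps0 ->
    `|v| <= r -> `|v'| <= r -> v = eps *: Phi eps v ->
    v' = eps' *: Phi eps' v' -> `|v - v'| <= (2 * K + 1) * `|eps - eps'|.
  move=> ee ee' vr vr' vE vE'.
  by have := key _ _ _ _ ee ee' vr vr'; rewrite -vE -vE'; lra.
exists eps0, z; split => //.
- by rewrite !lt_min ltr01 divr_gt0 // invr_gt0 mulr_gt0.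
- move=> eps v ee vr vE; have [zr zE] := zP _ ee.
  apply/eqP; rewrite -subr_eq0 -normr_le0.
  by have := lip _ _ _ _ ee ee vr zr vE zE; rewrite subrr normr0 mulr0.
- move=> eps eps' ee ee'; have [[zr zE] [zr' zE']] := (zP _ ee, zP _ ee').
  exact: lip.
Qed.

(** * The gain as a function of the intensities *)

(** The combinations [N - n] and [N + n] of the components of [y (a, b)], as
    functions of the intensities [A = a ^+ 2] and [B = b ^+ 2]; passing from
    one to the other exchanges [A] and [B] (see [y_gain]). *)
Definition gain (R : realType) (delta mu A B : R) : R :=
  mu * (delta + 2 * B) / (delta + (1 + delta) * (A + B) + 4 * A * B).

(** What remains of [gain] at [A = P / (eps xi^2)], [B = Q / (eps eta^2)] once
    a factor [eps] is taken out (see [gain_rescale]).  Clearing the powers of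
    [eps], [xi] and [eta] leaves a quotient of polynomials whose denominator is
    at least [4 P Q] for [eps >= 0], hence a function that is regular up to
    [eps = 0]. *)
Definition rgain (R : realType) (delta mu eps P Q xi eta : R) : R :=
  mu * (delta * eps * (xi * eta) ^+ 2 + 2 * (Q * xi ^+ 2)) /
  (delta * (eps * (xi * eta)) ^+ 2 +
   (1 + delta) * eps * (P * eta ^+ 2 + Q * xi ^+ 2) + 4 * (P * Q)).

Lemma gain_den_gt0 (R : realType) (delta A B : R) :
  0 < delta -> 0 <= A -> 0 <= B ->
  0 < delta + (1 + delta) * (A + B) + 4 * A * B.
Proof.
move=> delta_gt0 A0 B0.
rewrite -addrA ltr_wpDr // addr_ge0 ?mulr_ge0 ?addr_ge0 //.
exact: ltW.
Qed.

Lemma gain_ge0 (R : realType) (delta mu A B : R) :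
  0 < delta -> 0 < mu -> 0 <= A -> 0 <= B -> 0 <= gain delta mu A B.
Proof.
move=> delta_gt0 mu_gt0 A0 B0.
rewrite divr_ge0 ?(ltW (gain_den_gt0 delta_gt0 A0 B0)) //.
by rewrite mulr_ge0 ?addr_ge0 ?mulr_ge0 ?(ltW mu_gt0) ?(ltW delta_gt0).
Qed.

(** Far from sharp, but valid for all intensities: it starts the a priori
    bound, since it forbids a component of [E] from being small. *)
Lemma gain_le (R : realType) (delta mu A B : R) :
  0 < delta -> 0 < mu -> 0 <= A -> 0 <= B -> gain delta mu A B <= 2 * mu.
Proof.
move=> delta_gt0 mu_gt0 A0 B0; rewrite ler_pdivrMr ?gain_den_gt0 //.
rewrite [2 * mu]mulrC -[leRHS]mulrA ler_pM2l //.
have dA : 0 <= delta * A := mulr_ge0 (ltW delta_gt0) A0.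
have dB : 0 <= delta * B := mulr_ge0 (ltW delta_gt0) B0.
have AB : 0 <= A * B := mulr_ge0 A0 B0.
lra.
Qed.

(** The bound is uniform in [B], so the two components of [E] can be treated
    one at a time. *)
Lemma gain_decay (R : realType) (delta mu A B : R) :
  0 < delta -> 0 < mu -> 0 < A -> 0 <= B -> gain delta mu A B <= mu / A.
Proof.
move=> delta_gt0 mu_gt0 A0 B0; rewrite ler_pdivrMr ?gain_den_gt0 ?(ltW A0) //.
rewrite -[leRHS]mulrA ler_pM2l // ler_pdivlMl //.
have dB : 0 <= delta * B := mulr_ge0 (ltW delta_gt0) B0.
have AB : 0 <= A * B := mulr_ge0 (ltW A0) B0.
lra.
Qed.

Lemma gain_rescale (R : realType) (delta mu eps P Q xi eta : R) :
  0 < delta -> 0 < eps -> 0 < P -> 0 < Q -> 0 < xi -> 0 < eta ->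
  gain delta mu (P / (eps * xi ^+ 2)) (Q / (eps * eta ^+ 2)) =
  eps * rgain delta mu eps P Q xi eta.
Proof.
move=> delta_gt0 e0 P0 Q0 x0 y0.
have d0 : 0 < delta * (eps * (xi * eta)) ^+ 2 +
   (1 + delta) * eps * (P * eta ^+ 2 + Q * xi ^+ 2) + 4 * (P * Q).
  by rewrite !(addr_gt0, mulr_gt0, exprn_gt0).
rewrite /gain /rgain; field.
by rewrite !gt_eqF.
Qed.

Lemma rgain_bounded_lipschitz (R : realType) (delta mu : R)
    (V : normedModType R) (D : set V) (P Q : R) (e xi eta : V -> R) :
  0 < delta -> 0 < P -> 0 < Q -> (forall u, D u -> 0 <= e u) ->
  bounded_lipschitz D e -> bounded_lipschitz D xi -> bounded_lipschitz D eta ->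
  bounded_lipschitz D (fun u => rgain delta mu (e u) P Q (xi u) (eta u)).
Proof.
move=> delta_gt0 P0 Q0 e0 Le Lx Ly.
have LC c : bounded_lipschitz D (fun=> c) by exact: bounded_lipschitz_cst.
have PQ0 : 0 < 4 * (P * Q) by rewrite !mulr_gt0.
have den_ge u : D u -> 4 * (P * Q) <=
    delta * (e u * (xi u * eta u)) ^+ 2 +
    (1 + delta) * e u * (P * eta u ^+ 2 + Q * xi u ^+ 2) + 4 * (P * Q).
  move=> /e0 eu0.
  rewrite lerDr addr_ge0 // mulr_ge0 ?sqr_ge0 ?(ltW delta_gt0) //.
    by rewrite mulr_ge0 // addr_ge0 // ltW.
  by rewrite addr_ge0 // mulr_ge0 ?sqr_ge0 ?ltW.
by do !(exact: LC || exact: Le || exact: Lx || exact: Ly || exact: den_ge ||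
  apply: bounded_lipschitzD || apply: bounded_lipschitzX ||
  apply: (bounded_lipschitzV PQ0) || apply: bounded_lipschitzM).
Qed.

(** * The equilibrium branch of the gains *)

Lemma norm_rV_le (R : realType) n (v : 'rV[R]_n) (c : R) :
  0 <= c -> (`|v| <= c) <-> (forall j, `|v 0 j| <= c).
Proof.
move=> c0; rewrite [`|v|]/Num.norm /= mx_normrE; split=> [|vc].
  by move=> /bigmax_leP[_ vc] j; exact: (vc (0, j)).
by apply/bigmax_leP; split=> // -[i j] _; rewrite ord1.
Qed.

Lemma norm_pair_le (R : realType) (V : normedModType R) (u : R * V) :
  [/\ `|u.1| <= `|u|, `|u.2| <= `|u| & `|u| <= `|u.1| + `|u.2|].
Proof.
rewrite prod_normE; split; rewrite ?le_max ?lexx ?orbT //.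
by rewrite ge_max lerDl lerDr !normr_ge0.
Qed.

(** The pair of gains is a fixed point in ['rV[R]_2] with the maximum norm, so
    [small_fixed_point] needs completeness there. *)
HB.instance Definition _ (R : realType) m n := Complete.on 'M[R]_(m.+1, n.+1).

(** The whole nonlinear problem, in the small parameter [eps = |lambda| ^- 2].
    With [P] and [Q] the squared moduli of the components of
    [uh / (1 + i alpha)], the moduli of the two equations for [E] say
    [(1 - x)^2 A = P / eps] and [(1 - y)^2 B = Q / eps], where
    [x = gain A B] and [y = gain B A].

    Any solution lies in the square [|x|, |y| <= 1 / 2]: from [x <= 2 mu] one
    gets [A >= P / (eps (1 + 2 mu)^2)], whence
    [x <= mu / A <= eps mu (1 + 2 mu)^2 / P].
    Inside the square [A] and [B] can be eliminated and, by [gain_rescale],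
    the problem reads [(x, y) = eps *: Phi eps (x, y)] with [Phi] bounded and
    Lipschitz, so that [small_fixed_point] applies. *)
Lemma gain_branch (R : realType) (delta mu P Q : R) :
  0 < delta -> 0 < mu -> 0 < P -> 0 < Q ->
  exists (eps0 K M : R) (x y : R -> R), [/\ 0 < eps0,
    forall eps, 0 < eps <= eps0 ->
      [/\ x eps <= 1 / 2, y eps <= 1 / 2,
          `|x eps| <= K * eps & `|y eps| <= K * eps],
    forall eps, 0 < eps <= eps0 ->
      x eps = gain delta mu (P / (eps * (1 - x eps) ^+ 2))
                            (Q / (eps * (1 - y eps) ^+ 2)) /\
      y eps = gain delta mu (Q / (eps * (1 - y eps) ^+ 2))
                            (P / (eps * (1 - x eps) ^+ 2)),
    forall eps A B, 0 < eps <= eps0 -> 0 <= A -> 0 <= B ->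
      (1 - gain delta mu A B) ^+ 2 * A = P / eps ->
      (1 - gain delta mu B A) ^+ 2 * B = Q / eps ->
      gain delta mu A B = x eps /\ gain delta mu B A = y eps &
    forall eps eps', 0 < eps <= eps0 -> 0 < eps' <= eps0 ->
      `|x eps - x eps'| <= M * `|eps - eps'| /\
      `|y eps - y eps'| <= M * `|eps - eps'| ].
Proof.
move=> d0 mu0 P0 Q0.
pose D : set (R * 'rV[R]_2)%type := [set u | 0 <= u.1 <= 1 /\ `|u.2| <= 1 / 2].
have De u : D u -> 0 <= u.1 by case=> /andP[].
have Le : bounded_lipschitz D fst.
  exists 1 => u v [/andP[u0 u1] _] _; rewrite ger0_norm // mul1r; split=> //.
  by have [] := norm_pair_le (u - v).
have Lxi (j : 'I_2) : bounded_lipschitz D (fun u => 1 - u.2 0 j).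
  exists 2 => u v [_ uj] [_ vj]; move/norm_rV_le: uj => /(_ _ j) uj.
  split.
    by rewrite (le_trans (ler_normB _ _)) // normr1; have := uj ltac:(lra); lra.
  have -> : 1 - u.2 0 j - (1 - v.2 0 j) = - ((u - v).2 0 j).
    by rewrite !mxE; ring.
  rewrite normrN; have [_ + _] := norm_pair_le (u - v).
  move/norm_rV_le => /(_ _ j) H; apply: le_trans (H _) _ => //.
  by rewrite ler_peMl //; lra.
have [K1 L1] := rgain_bounded_lipschitz mu d0 P0 Q0 De Le (Lxi 0) (Lxi 1).
have [K2 L2] := rgain_bounded_lipschitz mu d0 Q0 P0 De Le (Lxi 1) (Lxi 0).
pose Phi (eps : R) (v : 'rV[R]_2) : 'rV[R]_2 := \row_j
  (if j == 0 then rgain delta mu eps P Q (1 - v 0 0) (1 - v 0 1)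
   else rgain delta mu eps Q P (1 - v 0 1) (1 - v 0 0)).
pose K := `|K1| + `|K2| + 1.
have K0 : 0 < K by rewrite ltr_wpDl // addr_ge0.
have K1K : K1 <= K.
  by rewrite /K -addrA (le_trans (ler_norm K1)) // lerDl addr_ge0.
have K2K : K2 <= K.
  by rewrite /K addrAC (le_trans (ler_norm K2)) // lerDr addr_ge0.
have r0 : 0 < 1 / 2 :> R by lra.
have PhiK eps v : 0 <= eps <= 1 -> `|v| <= 1 / 2 -> `|Phi eps v| <= K.
  move=> e1 v1; apply/norm_rV_le; first exact: ltW.
  move=> j; rewrite mxE; have Dv : D (eps, v) by [].
  case: ifP => _; first by have [/le_trans-> //] := L1 _ _ Dv Dv.
  by have [/le_trans-> //] := L2 _ _ Dv Dv.
have [|eps0 [z [e0 zP zU zL]]] := small_fixed_point (Phi := Phi) r0 K0 PhiK.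
  move=> eps eps' v v' e1 e1' v1 v1'; apply/norm_rV_le.
    by rewrite mulr_ge0 ?addr_ge0 // ltW.
  have Dv : D (eps, v) by []. have Dv' : D (eps', v') by [].
  have [_ _ nP] := norm_pair_le ((eps, v) - (eps', v')).
  have [[_ l1] [_ l2]] := (L1 _ _ Dv Dv', L2 _ _ Dv Dv').
  move=> j; rewrite !mxE; case: ifP => _.
    rewrite (le_trans l1) // (le_trans (ler_wpM2r _ K1K)) //.
    by rewrite ler_wpM2l // ltW.
  rewrite (le_trans l2) // (le_trans (ler_wpM2r _ K2K)) //.
  by rewrite ler_wpM2l // ltW.
(* The last bound on [eps] is the one that makes [mu / A <= 1 / 2]. *)
pose eps1 := Num.min 1
  (Num.min eps0 (Num.min P Q / (2 * mu * (1 + 2 * mu) ^+ 2))).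
have c0 : 0 < 2 * mu * (1 + 2 * mu) ^+ 2.
  have m0 : 0 < 1 + 2 * mu by rewrite addr_gt0 // mulr_gt0.
  by rewrite !mulr_gt0.
have small eps : 0 < eps <= eps1 ->
    [/\ 0 <= eps <= 1, 0 <= eps <= eps0,
        2 * mu * (1 + 2 * mu) ^+ 2 <= P / eps &
        2 * mu * (1 + 2 * mu) ^+ 2 <= Q / eps].
  move=> /andP[ep]; rewrite !le_min ler_pdivlMr // le_min.
  move=> /and3P[e1 e2 /andP[eP eQ]].
  by rewrite !ler_pdivlMr // mulrC (ltW ep) e1 e2 eP eQ.
have zb eps : 0 < eps <= eps1 -> forall j, `|z eps 0 j| <= 1 / 2.
  by move=> /small[_ e1 _ _] j; have [/norm_rV_le H _] := zP _ e1; exact/H/ltW.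
have xi0 eps : 0 < eps <= eps1 -> forall j, 0 < 1 - z eps 0 j.
  by move=> e1 j; have := zb _ e1 j; rewrite ler_norml; lra.
exists eps1, K, (2 * K + 1), (fun eps => z eps 0 0), (fun eps => z eps 0 1).
split=> //.
- rewrite !lt_min ltr01 e0 divr_gt0 //.
  by rewrite lt_min P0 Q0.
- move=> eps e1; have [e2 e3 _ _] := small _ e1.
  have [zr zE] := zP _ e3; have /andP[ep _] := e1.
  have zK j : `|z eps 0 j| <= K * eps.
    rewrite {1}zE mxE normrM gtr0_norm // mulrC ler_wpM2r ?(ltW ep) //.
    by move: j; apply/norm_rV_le; [exact: ltW|exact: PhiK].
  split=> //; by apply: le_trans (ler_norm _) _; exact: zb.
- move=> eps e1; have [_ e3 _ _] := small _ e1; have /andP[ep _] := e1.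
  have [_ zE] := zP _ e3.
  by rewrite !gain_rescale ?xi0 //; split; rewrite {1}zE !mxE.
- move=> eps A B e1 A0 B0 HA HB.
  have [e2 e3 cP cQ] := small _ e1; have /andP[ep _] := e1.
  have half A' B' P' : 0 <= A' -> 0 <= B' -> 0 < P' ->
      2 * mu * (1 + 2 * mu) ^+ 2 <= P' / eps ->
      (1 - gain delta mu A' B') ^+ 2 * A' = P' / eps ->
      `|gain delta mu A' B'| <= 1 / 2.
    move=> A0' B0' P0' cP' HP'.
    have g0 := gain_ge0 d0 mu0 A0' B0'; have g1 := gain_le d0 mu0 A0' B0'.
    rewrite ger0_norm //.
    have A'gt0 : 0 < A'.
      rewrite lt_def A0' andbT; apply: contraTneq cP' => A'E.
      by rewrite -HP' A'E mulr0 -ltNge.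
    apply: le_trans (gain_decay d0 mu0 A'gt0 B0') _.
    rewrite ler_pdivrMr //.
    suff : 2 * mu * (1 + 2 * mu) ^+ 2 <= (1 + 2 * mu) ^+ 2 * A'.
      by rewrite mulrC ler_pM2l ?exprn_gt0 //; lra.
    rewrite (le_trans cP') // -HP' ler_wpM2r //.
    have -> : (1 + 2 * mu) ^+ 2 = (1 - gain delta mu A' B') ^+ 2 +
        (2 * mu + gain delta mu A' B') * (2 + 2 * mu - gain delta mu A' B').
      by ring.
    by rewrite lerDl mulr_ge0 //; lra.
  pose v : 'rV[R]_2 := \row_j
    (if j == 0 then gain delta mu A B else gain delta mu B A).
  have gA := half _ _ _ A0 B0 P0 cP HA; have gB := half _ _ _ B0 A0 Q0 cQ HB.
  have lt1 g : `|g| <= 1 / 2 -> 0 < 1 - g :> R by rewrite ler_norml; lra.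
  have unfoldE A' P' g : `|g| <= 1 / 2 -> (1 - g) ^+ 2 * A' = P' / eps ->
      A' = P' / (eps * (1 - g) ^+ 2).
    move=> /lt1 g0 gE; rewrite invfM mulrA -gE mulrC mulKf //.
    by rewrite sqrf_eq0 gt_eqF.
  have AE : A = P / (eps * (1 - gain delta mu A B) ^+ 2) by exact: unfoldE.
  have BE : B = Q / (eps * (1 - gain delta mu B A) ^+ 2) by exact: unfoldE.
  have : v = z eps.
    apply: zU => //.
      by apply/norm_rV_le; [exact: ltW|move=> j; rewrite mxE; case: ifP].
    apply/rowP => j; rewrite !mxE /=.
    by case: ifP => _; rewrite -gain_rescale // -?AE -?BE ?lt1.
  by move=> <-; split; rewrite mxE.
- move=> eps eps' /small[_ e1 _ _] /small[_ e1' _ _].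
  have M0 : 0 <= (2 * K + 1) * `|eps - eps'|.
    by rewrite mulr_ge0 // addr_ge0 // mulr_ge0 // ltW.
  have zj := (norm_rV_le (z eps - z eps') M0).1 (zL _ _ e1 e1').
  by split; [have := zj 0 | have := zj 1]; rewrite !mxE.
Qed.

(** * Modulus and argument *)

Lemma normr_cmod (R : rcfType) (z : R[i]) : `|z| = (cmod z)%:C.
Proof. by rewrite normc_def; case: z. Qed.

Lemma cmod_real (R : rcfType) (r : R) : cmod r%:C = `|r|.
Proof. by rewrite /= expr0n addr0 sqrtr_sqr. Qed.

Lemma cmod_ge0 (R : rcfType) (z : R[i]) : 0 <= cmod z.
Proof. by case: z => a b; exact: sqrtr_ge0. Qed.

Lemma cmod_gt0 (R : rcfType) (z : R[i]) : z != 0 -> 0 < cmod z.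
Proof.
move=> z0; rewrite lt_def cmod_ge0 andbT.
by apply: contra_neq z0; exact: ComplexField.Normc.eq0_normc.
Qed.

Lemma ler_dist_cmod (R : rcfType) (z w : R[i]) :
  `|cmod z - cmod w| <= cmod (z - w).
Proof.
rewrite -lecR -normr_cmod -cmod_real -normr_cmod rmorphB /= -!normr_cmod.
exact: ler_dist_dist.
Qed.

Lemma expi_carg (R : realType) (z : R[i]) :
  z != 0 -> z = (cmod z)%:C * expi (carg z).
Proof.
move=> z0; have c0 := cmod_gt0 z0.
case: z z0 c0 => a b z0; set c := cmod _ => c0.
have cE : c ^+ 2 = a ^+ 2 + b ^+ 2.
  by rewrite /c /= sqr_sqrtr // addr_ge0 ?sqr_ge0.
have ac : -1 <= a / c <= 1.
  rewrite -ler_norml normrM normfV (gtr0_norm c0) ler_pdivrMr // mul1r.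
  by rewrite -sqrtr_sqr /c /= ler_wsqrtr // lerDl sqr_ge0.
have sE : Num.sqrt (1 - (a / c) ^+ 2) = `|b| / c.
  rewrite -[`|b| / c]ger0_norm ?divr_ge0 ?(ltW c0) // -sqrtr_sqr.
  congr Num.sqrt; rewrite !expr_div_n real_normK ?num_real //.
  by rewrite cE; field; rewrite -cE sqrf_eq0 gt_eqF.
have cosE : cos (acos (a / c)) = a / c by rewrite acosK // in_itv.
have sinE : sin (acos (a / c)) = `|b| / c by rewrite sin_acos.
rewrite /carg /expi /= -/c; case: (leP 0 b) => b0.
  simpc; rewrite cosE sinE (ger0_norm b0).
  by congr (_ +i* _); field; rewrite gt_eqF.
simpc; rewrite cosN sinN cosE sinE (ltr0_norm b0).
by congr (_ +i* _); field; rewrite gt_eqF.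
Qed.

Lemma expiN_carg (R : realType) (z : R[i]) :
  z != 0 -> z^-1 = expi (- carg z) / (cmod z)%:C.
Proof.
move=> z0; have c0 : (cmod z)%:C != 0.
  by apply: contra_neq (negbT (gt_eqF (cmod_gt0 z0))) => /complexI.
have e1 : expi (carg z) * expi (- carg z) = 1.
  rewrite /expi cosN sinN; simpc; apply/eqP; rewrite eq_complex /=.
  by rewrite -!expr2 cos2Dsin2 mulrC addNr !eqxx.
apply: (mulfI z0); rewrite divff // mulrA {1}(expi_carg z0).
by rewrite -[_ * _ * expi _]mulrA e1 mulr1 divff.
Qed.

(** * Continuity of complex-valued functions *)

Lemma cvg_real_complex (R : realType) (T : Type) (F : set_system T)
    (FF : Filter F) (h : T -> R) (r : R) :
  h t @[t --> F] --> r -> ((h t)%:C : R[i]^o) @[t --> F] --> (r%:C : R[i]^o).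
Proof.
move=> hr; apply/cvgrPdist_lt => e e0.
(* A positive element of [R[i]] is a positive real. *)
have [e1 eE] : 0 < complex.Re e /\ e = (complex.Re e)%:C.
  by move: e0; case: (e) => a b /=; rewrite ltcE /= => /andP[/eqP-> ->].
near=> t; rewrite eE -rmorphB normr_cmod cmod_real ltcR.
by near: t; exact: cvgr_dist_lt hr _ e1.
Unshelve. all: by end_near. Qed.

Lemma continuous_cmod (R : realType) (w : R[i]) :
  cmod z @[z --> (w : R[i]^o)] --> cmod w.
Proof.
have FF := nbhs_filter (w : R[i]^o).
apply/cvgrPdist_lt => e e0.
have e1 : 0 < e%:C :> R[i] by rewrite ltcR.
near=> z; apply: le_lt_trans (ler_dist_cmod _ _) _.
rewrite -ltcR -normr_cmod; near: z.
exact: (@cvgr_dist_lt _ R[i]^o _ _ (nbhs_filter (w : R[i]^o)) id w).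
Unshelve. all: by end_near. Qed.

Lemma continuous_on_col2 (R : realType) (D : set R[i]) (f g : R[i] -> R[i]) :
  (forall z, D z -> (f w : R[i]^o) @[w --> within D (nbhs (z : R[i]^o))]
                    --> (f z : R[i]^o)) ->
  (forall z, D z -> (g w : R[i]^o) @[w --> within D (nbhs (z : R[i]^o))]
                    --> (g z : R[i]^o)) ->
  continuous_on D (fun z => col2 (f z) (g z)).
Proof.
move=> cf cg; apply/subspace_continuousP => z Dz.
have FF : Filter (within D (nbhs (z : R[i]^o))).
  exact: within_filter.
apply/cvg_ballP => e e0; near=> w; split=> // i j; rewrite !mxE.
case: ifP => _; near: w.
  by move/cvg_ballP: (cf z Dz); apply.
by move/cvg_ballP: (cg z Dz); apply.
Unshelve. all: by end_near. Qed.

(** * Equilibria in components *)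

Lemma eq_col2 (T : Type) (a b c d : T) :
  col2 a b = col2 c d <-> a = c /\ b = d.
Proof.
split=> [/matrixP H|[-> ->] //].
by have := H 0 0; have := H 1 0; rewrite !mxE.
Qed.

Lemma col2E (T : Type) (v : 'cV[T]_2) : v = col2 (fst2 v) (snd2 v).
Proof.
apply/matrixP => i j; rewrite mxE ord1.
by case: i => [[|[|//]] ?] /=; congr (v _ _); exact: val_inj.
Qed.

(** The equation for [E] is diagonal, and its coefficients [1 - (N - n)] and
    [1 - (N + n)] are real.  The equation for [(N, n)] is linear with an
    invertible matrix that sees [E] only through the two moduli. *)
Lemma equilibriumE (R : realType) (kappa gamma delta alpha mu : R)
    (u E : 'cV[R[i]]_2) (N n : R) :
  0 < kappa -> 0 < gamma -> 0 < delta ->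
  equilibrium kappa gamma delta alpha mu u E N n <->
  [/\ col2 N n = y delta mu (col2 (cmod (fst2 E)) (cmod (snd2 E))),
      (1 - (N - n))%:C * fst2 E = fst2 u / (1 +i* alpha) &
      (1 - (N + n))%:C * snd2 E = snd2 u / (1 +i* alpha)].
Proof.
move=> k0 g0 d0; have a0 : (1 +i* alpha) != 0 :> R[i].
  by rewrite eq_complex /= oner_eq0.
have EP : (fieldE kappa alpha u E N n = 0) <->
    (1 - (N - n))%:C * fst2 E = fst2 u / (1 +i* alpha) /\
    (1 - (N + n))%:C * snd2 E = snd2 u / (1 +i* alpha).
  have XE : (1 +i* alpha) *: X (col2 N%:C n%:C) *m E =
      col2 ((1 - (N - n))%:C * fst2 E * (1 +i* alpha))
           ((1 - (N + n))%:C * snd2 E * (1 +i* alpha)).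
    apply/matrixP => i j; rewrite !mxE big_ord_recl big_ord1 !mxE ord1.
    have -> : lift ord0 ord0 = 1 :> 'I_2 by exact: val_inj.
    by case: i => [[|[|//]] ?] /=;
      rewrite ?(rmorphB, rmorphD, rmorph1) /=;
      set e0 := E _ _; set e1 := E _ _; ring.
  apply: (@iff_trans _ (col2 ((1 - (N - n))%:C * fst2 E * (1 +i* alpha))
           ((1 - (N + n))%:C * snd2 E * (1 +i* alpha)) =
        col2 (fst2 u) (snd2 u))).
    rewrite /fieldE XE -col2E; split=> [/eqP|->]; last first.
      by rewrite subrr scaler0 oppr0.
    rewrite oppr_eq0 scaler_eq0 subr_eq0 => /orP[/eqP/complexI k|/eqP //].
    by move: k0; rewrite k ltxx.
  split=> [/eq_col2|] [H0 H1].
    by split; [rewrite -H0|rewrite -H1]; rewrite mulfK.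
  by apply/eq_col2; split; [rewrite H0|rewrite H1]; rewrite divfK.
have NP : (fieldN gamma delta mu E N n = 0) <->
    col2 N n = y delta mu (col2 (cmod (fst2 E)) (cmod (snd2 E))).
  set a := cmod _; set b := cmod _.
  have YE : Y delta E = Y delta (map_mx (fun r : R => r%:C) (col2 a b)).
    by rewrite /Y /norm2 !mxE !cmod_real /= !ger0_norm ?cmod_ge0.
  have Yu : Y delta (map_mx (fun r : R => r%:C) (col2 a b)) \in unitmx.
    rewrite unitmxE unitfE.
    have -> : map_mx (fun r : R => r%:C) (col2 a b) = col2 a%:C b%:C.
      by apply/matrixP => i j; rewrite !mxE; case: ifP.
    by rewrite gt_eqF ?det_Y_gt0.
  rewrite /fieldN YE /y; split=> [/eqP|->]; last first.
    by rewrite mulKVmx // subrr scaler0 oppr0.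
  rewrite oppr_eq0 scaler_eq0 gt_eqF //= subr_eq0 => /eqP <-.
  by rewrite mulKmx.
by split=> [[/EP[? ?] /NP ?]|[/NP ? ? ?]]; split=> //; apply/EP.
Qed.

Lemma y_gain (R : realType) (delta mu a b N n : R) : 0 < delta ->
  col2 N n = y delta mu (col2 a b) <->
  N - n = gain delta mu (a ^+ 2) (b ^+ 2) /\
  N + n = gain delta mu (b ^+ 2) (a ^+ 2).
Proof.
move=> d0; rewrite y_explicit // det_Y.
have := gain_den_gt0 d0 (sqr_ge0 a) (sqr_ge0 b); rewrite /gain.
have -> : delta + (1 + delta) * (b ^+ 2 + a ^+ 2) + 4 * b ^+ 2 * a ^+ 2 =
          delta + (1 + delta) * (a ^+ 2 + b ^+ 2) + 4 * a ^+ 2 * b ^+ 2 by ring.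
set D := delta + _ + _ => D0.
have -> : (mu / D) *: col2 (delta + (a ^+ 2 + b ^+ 2)) (a ^+ 2 - b ^+ 2) =
    col2 (mu / D * (delta + (a ^+ 2 + b ^+ 2))) (mu / D * (a ^+ 2 - b ^+ 2)).
  by apply/matrixP => i j; rewrite !mxE; case: ifP.
split=> [/eq_col2[-> ->]|[H0 H1]].
  by split; field; rewrite gt_eqF.
have NE : N = ((N - n) + (N + n)) / 2 by field.
have nE : n = ((N + n) - (N - n)) / 2 by field.
by apply/eq_col2; split; [rewrite NE|rewrite nE]; rewrite H0 H1; field;
  rewrite gt_eqF.
Qed.

(** * The branch of fields *)

Lemma norm2_le (R : realType) (v w : 'cV[R[i]]_2) (k : R) :
  0 <= k -> cmod (fst2 v) <= k * cmod (fst2 w) ->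
  cmod (snd2 v) <= k * cmod (snd2 w) -> norm2 v <= k * norm2 w.
Proof.
move=> k0 v0 v1.
rewrite -[X in X * _]ger0_norm // -sqrtr_sqr -sqrtrM ?sqr_ge0 //.
rewrite ler_wsqrtr // mulrDr -!exprMn.
by rewrite lerD // ler_pXn2r ?nnegrE ?mulr_ge0 ?cmod_ge0.
Qed.

Lemma cvg_branch (R : realType) (L eps0 M : R) (c : R[i]) (x : R -> R) :
  0 < L ->
  (forall lam, L <= cmod lam -> 0 < cmod lam ^- 2 <= eps0) ->
  (forall eps, 0 < eps <= eps0 -> x eps <= 1 / 2) ->
  (forall eps eps', 0 < eps <= eps0 -> 0 < eps' <= eps0 ->
     `|x eps - x eps'| <= M * `|eps - eps'|) ->
  forall lam : R[i], L <= cmod lam ->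
  (l * c * ((1 - x (cmod l ^- 2))^-1)%:C : R[i]^o)
     @[l --> within [set l | L <= cmod l] (nbhs (lam : R[i]^o))] -->
  (lam * c * ((1 - x (cmod lam ^- 2))^-1)%:C : R[i]^o).
Proof.
move=> L0 Lsmall xb xL lam Llam.
set F := within _ _.
have FF : Filter F by exact: within_filter.
have c0 : 0 < cmod lam := lt_le_trans L0 Llam.
have Fid : (l : R[i]^o) @[l --> F] --> (lam : R[i]^o) by exact: cvg_within.
have Fc : cmod l @[l --> F] --> cmod lam.
  exact: (cvg_comp _ _ Fid (@continuous_cmod _ lam)).
have Fe : cmod l ^- 2 @[l --> F] --> cmod lam ^- 2.
  apply: cvgV; first by rewrite sqrf_eq0 gt_eqF.
  exact: (cvgM Fc Fc).
have Fx : x (cmod l ^- 2) @[l --> F] --> x (cmod lam ^- 2).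
  apply/cvgrPdist_lt => e e0.
  have M0 : 0 < `|M| + 1 by rewrite ltr_wpDl.
  have eM : 0 < e / (`|M| + 1) by rewrite divr_gt0.
  near=> l.
  have Ll : L <= cmod l by near: l; exact: withinT.
  apply: le_lt_trans (xL _ _ (Lsmall _ Llam) (Lsmall _ Ll)) _.
  apply: (@le_lt_trans _ _ ((`|M| + 1) * `|cmod lam ^- 2 - cmod l ^- 2|)).
    by rewrite ler_wpM2r // (le_trans (ler_norm M)) // lerDl.
  rewrite mulrC -ltr_pdivlMr //.
  by near: l; exact: cvgr_dist_lt Fe _ eM.
have Fs : (((1 - x (cmod l ^- 2))^-1)%:C : R[i]^o) @[l --> F] -->
    (((1 - x (cmod lam ^- 2))^-1)%:C : R[i]^o).
  apply: cvg_real_complex; apply: cvgV.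
    by rewrite gt_eqF //; have := xb _ (Lsmall _ Llam); lra.
  by apply: cvgB => //; exact: cvg_cst.
have Fc' : (c : R[i]^o) @[l --> F] --> (c : R[i]^o) by exact: cvg_cst.
exact: (cvgM (cvgM Fid Fc') Fs).
Unshelve. all: by end_near. Qed.

Theorem theorem17 (R : realType) (kappa gamma delta alpha mu : R)
    (kappa_gt0 : 0 < kappa) (gamma_gt0 : 0 < gamma) (delta_gt0 : 0 < delta)
    (mu_gt1 : 1 < mu)
    (uh : 'cV[R[i]]_2) (uhm_neq0 : fst2 uh != 0) (uhp_neq0 : snd2 uh != 0) :
  exists (L : R) (Eu : R[i] -> 'cV[R[i]]_2),
    [/\ 0 < L,
        continuous_on [set lam | L <= cmod lam] Eu,
        forall lam : R[i], L <= cmod lam ->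
          forall (E : 'cV[R[i]]_2) (N n : R),
            equilibrium kappa gamma delta alpha mu (lam *: uh) E N n <->
            E = Eu lam /\
            col2 N n = y delta mu (col2 (cmod (fst2 E)) (cmod (snd2 E)))
      & let theta := - carg (1 +i* alpha) in
        exists (C : R) (e : R[i] -> 'cV[R[i]]_2),
          0 < C /\
          forall lam : R[i], L <= cmod lam ->
            Eu lam =
              (lam * expi theta / (cmod (1 +i* alpha))%:C) *: (uh + e lam) /\
            norm2 (e lam) <= C / (cmod lam `^ (2 / 3))].
Proof.
have mu0 : 0 < mu := lt_trans ltr01 mu_gt1.
have a0 : 1 +i* alpha != 0 :> R[i] by rewrite eq_complex /= oner_eq0.
pose w0 := fst2 uh / (1 +i* alpha); pose w1 := snd2 uh / (1 +i* alpha).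
have w00 : w0 != 0 by rewrite mulf_neq0 ?invr_eq0.
have w10 : w1 != 0 by rewrite mulf_neq0 ?invr_eq0.
have P0 : 0 < cmod w0 ^+ 2 by rewrite exprn_gt0 ?cmod_gt0.
have Q0 : 0 < cmod w1 ^+ 2 by rewrite exprn_gt0 ?cmod_gt0.
have [eps0 [K [M [x [y1 [e0 xyb xyE xyU xyL]]]]]] :=
  gain_branch delta_gt0 mu0 P0 Q0.
(* As [L >= 1], [|lam| >= L] gives [|lam|^2 >= |lam| >= 1 / eps0]. *)
pose L := Num.max 1 eps0^-1.
have L0 : 0 < L by rewrite lt_max ltr01.
have Lsmall lam : L <= cmod lam -> 0 < cmod lam ^- 2 <= eps0.
  rewrite ge_max => /andP[l1 le]; have l0 := lt_le_trans ltr01 l1.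
  rewrite invr_gt0 exprn_gt0 //= invf_ple ?posrE ?exprn_gt0 //.
  by rewrite (le_trans le) // expr2 ler_peMr // ltW.
have sqr_modulus (w : R[i]) (lam : R[i]) (s : R) : lam != 0 -> 0 < 1 - s ->
    cmod (lam * w * ((1 - s)^-1)%:C) ^+ 2 =
    cmod w ^+ 2 / (cmod lam ^- 2 * (1 - s) ^+ 2).
  move=> l0 s0; rewrite !ComplexField.Normc.normcM cmod_real.
  rewrite gtr0_norm ?invr_gt0 //; have := cmod_gt0 l0.
  move: (cmod lam) (cmod w) => a b ap; field.
  by rewrite !gt_eqF.
have solve (w : R[i]) (lam z : R[i]) (s : R) : 0 < 1 - s ->
    (1 - s)%:C * z = lam * w <-> z = lam * w * ((1 - s)^-1)%:C.
  move=> s0; have sC : (1 - s)%:C != 0.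
    by apply: contra_neq (lt0r_neq0 s0) => /complexI.
  rewrite fmorphV /=; split=> [<-|->]; first by rewrite mulrC mulKf.
  by rewrite mulrC divfK.
exists L, (fun lam => col2
  (lam * w0 * ((1 - x (cmod lam ^- 2))^-1)%:C)
  (lam * w1 * ((1 - y1 (cmod lam ^- 2))^-1)%:C)).
split=> //.
- apply: continuous_on_col2 => lam Llam.
  + apply: (@cvg_branch _ L eps0 M w0 x L0 Lsmall) => //.
      by move=> eps /xyb[].
    by move=> eps eps' he he'; have [] := xyL _ _ he he'.
  + apply: (@cvg_branch _ L eps0 M w1 y1 L0 Lsmall) => //.
      by move=> eps /xyb[].
    by move=> eps eps' he he'; have [] := xyL _ _ he he'.
- move=> lam Llam E N n; have eb := Lsmall _ Llam.
  have [xb yb _ _] := xyb _ eb; have [xE yE] := xyE _ eb.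
  set s := x _ in xb xE *; set t := y1 _ in yb yE *.
  have s0 : 0 < 1 - s by lra. have t0 : 0 < 1 - t by lra.
  have l0 : lam != 0.
    by apply: contraTneq Llam => ->; rewrite ComplexField.Normc.normc0 -ltNge.
  split.
    move=> /(equilibriumE _ _ _ _ _ _ kappa_gt0 gamma_gt0 delta_gt0)[yNn H0 H1].
    split=> //; have [g0 g1] := (y_gain _ _ _ _ _ delta_gt0).1 yNn.
    rewrite mxE -mulrA -/w0 g0 in H0; rewrite mxE -mulrA -/w1 g1 in H1.
    have sqE g z w : (1 - g)%:C * z = lam * w ->
       (1 - g) ^+ 2 * cmod z ^+ 2 = cmod w ^+ 2 / cmod lam ^- 2.
      move=> /(congr1 (@ComplexField.Normc.normc R)).
      rewrite !ComplexField.Normc.normcM cmod_real.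
      move=> /(congr1 (fun r => r ^+ 2)).
      by rewrite !exprMn invrK real_normK ?num_real // [RHS]mulrC.
    have [gs gt] :=
      xyU _ _ _ eb (sqr_ge0 _) (sqr_ge0 _) (sqE _ _ _ H0) (sqE _ _ _ H1).
    rewrite [LHS]col2E; apply/eq_col2; split; apply/solve => //.
      by rewrite /s -gs.
    by rewrite /t -gt.
  move=> [EE yNn]; apply/equilibriumE => //.
  have [g0 g1] := (y_gain _ _ _ _ _ delta_gt0).1 yNn.
  have E0 : fst2 E = lam * w0 * ((1 - s)^-1)%:C by rewrite EE mxE.
  have E1 : snd2 E = lam * w1 * ((1 - t)^-1)%:C by rewrite EE mxE.
  rewrite E0 E1 !sqr_modulus // -xE in g0.
  rewrite E0 E1 !sqr_modulus // -yE in g1.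
  split=> //; rewrite mxE -[RHS]mulrA.
    by rewrite g0; apply/solve.
  by rewrite g1; apply/solve.
- set theta := - _ => /=.
  (* [1 / (1 - x) = 1 + x / (1 - x)], where the last term is at most
     [2 K eps] because [x <= 1 / 2]. *)
  exists (2 * `|K| * norm2 uh + 1), (fun lam =>
    let s := x (cmod lam ^- 2) in let t := y1 (cmod lam ^- 2) in
    col2 (fst2 uh * (s / (1 - s))%:C) (snd2 uh * (t / (1 - t))%:C)).
  have n0 : 0 <= norm2 uh by exact: sqrtr_ge0.
  split; first by rewrite ltr_wpDl // !mulr_ge0.
  move=> lam Llam; have eb := Lsmall _ Llam.
  have [xb yb xK yK] := xyb _ eb.
  set s := x _ in xb xK *; set t := y1 _ in yb yK *.
  have s0 : 0 < 1 - s by lra. have t0 : 0 < 1 - t by lra.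
  split.
    have thE : (1 +i* alpha)^-1 = expi theta / (cmod (1 +i* alpha))%:C.
      exact: expiN_carg.
    have geom r : 0 < 1 - r -> ((1 - r)^-1)%:C = 1 + (r / (1 - r))%:C :> R[i].
      move=> r0; rewrite -[1 : R[i]](rmorph1 (real_complex R)) -rmorphD /=.
      by congr _%:C; field; rewrite gt_eqF.
    rewrite [RHS]col2E !mxE /= -[lam * _ / _]mulrA -thE /w0 /w1.
    by apply/eq_col2; split; rewrite geom //; ring.
  have l1 : 1 <= cmod lam by apply: le_trans Llam; rewrite le_max lexx.
  have l0 := lt_le_trans ltr01 l1.
  have /andP[ep _] := eb.
  have factor r : r <= 1 / 2 -> `|r| <= K * cmod lam ^- 2 ->
      `|r / (1 - r)| <= 2 * `|K| * cmod lam ^- 2.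
    move=> r2 rK; have r0 : 0 < 1 - r by lra.
    rewrite normrM normfV (gtr0_norm r0) ler_pdivrMr //.
    have : `|r| <= `|K| * cmod lam ^- 2.
      by rewrite (le_trans rK) // ler_wpM2r ?ler_norm // ltW.
    set B := `|K| * _ => rB; have B0 : 0 <= B := le_trans (normr_ge0 _) rB.
    rewrite -mulrA -/B; have : 0 <= (1 - 2 * r) * B by rewrite mulr_ge0 //; lra.
    by lra.
  have en : norm2 (col2 (fst2 uh * (s / (1 - s))%:C)
                        (snd2 uh * (t / (1 - t))%:C)) <=
      (2 * `|K| * cmod lam ^- 2) * norm2 uh.
    apply: norm2_le; first by rewrite !mulr_ge0 // ltW.
      rewrite mxE ComplexField.Normc.normcM cmod_real mulrC.
      by rewrite ler_wpM2r ?cmod_ge0 ?factor.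
    rewrite mxE ComplexField.Normc.normcM cmod_real mulrC.
    by rewrite ler_wpM2r ?cmod_ge0 ?factor.
  apply: (le_trans en).
  have decay : cmod lam ^- 2 <= (cmod lam `^ (2 / 3))^-1.
    rewrite lef_pV2 ?posrE ?powR_gt0 ?exprn_gt0 //.
    rewrite -powR_mulrn ?(ltW l0) // ler_powR //; lra.
  rewrite mulrAC.
  apply: (@le_trans _ _ ((2 * `|K| * norm2 uh + 1) * cmod lam ^- 2)).
    by rewrite ler_wpM2r ?(ltW ep) // lerDl.
  by rewrite ler_wpM2l // addr_ge0 // !mulr_ge0.
Qed.
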